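(* Assume the CFL condition $$\Delta t^n<\min_{1\le\alpha\le N}\ \min_i\ \frac{\Delta x_i}{|u_{\alpha,i}|+2\sqrt{2gh_i}},$$ and let $(h_i^{n+1},u^{n+1}_{\alpha,i})$ be obtained from $(h_i,u_{\alpha,i})=(h_i^n,u^n_{\alpha,i})$ by the Euler step followed by the semi-implicit viscous and friction step described in the context. Let $$E_{\alpha,i}=\frac{h_{\alpha,i}}{2}(u_{\alpha,i})^2+\frac g2h_{\alpha,i}h_i+gz_{b,i}h_{\alpha,i},$$ and define $E_{\alpha,i}^{n+1}$ by the same formula at time $n+1$. Then, with the terms $\widetilde H,\widehat H,d_{\alpha,i},e_{\alpha,i}$ recalled at the end of the context, \begin{align*} E^{n+1}_{\alpha,i}\le{}&E_{\alpha,i}-\sigma_i\Bigl(\int_{\mathbb R}\widetilde H_{\alpha,i+1/2-}\,d\xi-\int_{\mathbb R}\widetilde H_{\alpha,i-1/2+}\,d\xi\Bigr)-\Delta t^n\Bigl(\int_{\mathbb R}\widehat H^{n+1-}_{\alpha+1/2,i}\,d\xi-\int_{\mathbb R}\widehat H^{n+1-}_{\alpha-1/2,i}\,d\xi\Bigr)\\ &+\int_{\mathbb R}d_{\alpha,i}\,d\xi+\int_{\mathbb R}e_{\alpha,i}\,d\xi+\Delta t^n\mathcal D_{\alpha,i}, \end{align*} with, writing $v_{\alpha,i}=u^{1/2}_{\alpha,i}$, \begin{align*} \mathcal D_{\alpha,i}={}&\frac{8\mu}{\Delta x_i}\Bigl(h_{\alpha,i+1/2}\frac{v_{\alpha,i+1}+v_{\alpha,i}}2\,\frac{v_{\alpha,i+1}-v_{\alpha,i}}{\Delta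 x_{i+1}+\Delta x_i}-h_{\alpha,i-1/2}\frac{v_{\alpha,i}+v_{\alpha,i-1}}2\,\frac{v_{\alpha,i}-v_{\alpha,i-1}}{\Delta x_i+\Delta x_{i-1}}\Bigr)\\ &+2\mu\frac{v_{\alpha+1,i}+v_{\alpha,i}}2\,\frac{v_{\alpha+1,i}-v_{\alpha,i}}{h_{\alpha+1,i}+h_{\alpha,i}}-2\mu\frac{v_{\alpha,i}+v_{\alpha-1,i}}2\,\frac{v_{\alpha,i}-v_{\alpha-1,i}}{h_{\alpha,i}+h_{\alpha-1,i}}\\ &-\frac{4\mu}{\Delta x_i}\Bigl(h_{\alpha,i+1/2}\frac{(v_{\alpha,i+1}-v_{\alpha,i})^2}{\Delta x_{i+1}+\Delta x_i}+h_{\alpha,i-1/2}\frac{(v_{\alpha,i}-v_{\alpha,i-1})^2}{\Delta x_i+\Delta x_{i-1}}\Bigr)\\ &-\mu\frac{(v_{\alpha+1,i}-v_{\alpha,i})^2}{h_{\alpha+1,i}+h_{\alpha,i}}-\mu\frac{(v_{\alpha,i}-v_{\alpha-1,i})^2}{h_{\alpha,i}+h_{\alpha-1,i}}-\kappa\,\delta_{1,\alpha}\,v_{\alpha,i}^2 . \end{align*}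
   Context: Data: $g>0$; viscosity $\mu\ge0$; friction coefficient $\kappa\ge0$; $N\ge1$ layers with $l_1,\dots,l_N>0$, $\sum_{\alpha=1}^N l_\alpha=1$; a one-dimensional grid of cells indexed by $i\in\mathbb Z$ with lengths $\Delta x_i>0$; a time step $\Delta t^n>0$; $\sigma_i=\Delta t^n/\Delta x_i$; discrete topography $z_{b,i}\in\mathbb R$ (independent of time). At time $t^n$ (superscript $n$ omitted): water depths $h_i$ and layer velocities $u_{\alpha,i}\in\mathbb R$; $h_{\alpha,i}=l_\alpha h_i$. Depths are positive where they appear in a denominator. Kinetic quantities are functions of $\xi\in\mathbb R$. Maxwellians: $\overline M_{\alpha,i}(\xi)=\frac1{g\pi}\bigl(2gh_i-(\xi-u_{\alpha,i})^2\bigr)_+^{1/2}$, $M_{\alpha,i}=l_\alpha\overline M_{\alpha,i}$; for any layer-$\alpha$ kinetic quantity $X_\alpha$, $\overline X_\alpha=X_\alpha/l_\alpha$. Kinetic entropy: $H(f,\xi,z)=\frac{\xi^2}{2}f+\frac{g^2\pi^2}{6}f^3+gzf$. Hydrostatic reconstruction: $z_{b,i+1/2}=\max(z_{b,i},z_{b,i+1})$, $h_{i+1/2-}=(h_i+z_{b,i}-z_{b,i+1/2})_+$, $h_{i+1/2+}=(h_{i+1}+z_{b,i+1}-z_{b,i+1/2})_+$; $\overline M_{\alpha,i+1/2-}(\xi)=\frac1{g\pi}\bigl(2gh_{i+1/2-}-(\xi-u_{\alpha,i})^2\bigr)_+^{1/2}$, $\overline M_{\alpha,i+1/2+}(\xi)=\frac1{g\pi}\bigl(2gh_{i+1/2+}-(\xi-u_{\alpha,i+1})^2\bigr)_+^{1/2}$,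 $M_{\alpha,i+1/2\pm}=l_\alpha\overline M_{\alpha,i+1/2\pm}$; $M_{\alpha,i+1/2}=\mathbf 1_{\xi>0}M_{\alpha,i+1/2-}+\mathbf 1_{\xi<0}M_{\alpha,i+1/2+}$; likewise at $i-1/2$ with $i$ replaced by $i-1$; $\delta M_{\alpha,i+1/2-}=(\xi-u_{\alpha,i})(M_{\alpha,i}-M_{\alpha,i+1/2-})$, $\delta M_{\alpha,i-1/2+}=(\xi-u_{\alpha,i})(M_{\alpha,i}-M_{\alpha,i-1/2+})$. Mass exchange: $G_{1/2,i}=G_{N+1/2,i}=0$, $\Delta x_iG_{\alpha+1/2,i}=\sum_{j=1}^\alpha\bigl(\int_{\mathbb R}\xi(M_{j,i+1/2}-M_{j,i-1/2})d\xi-l_j\sum_{p=1}^N\int_{\mathbb R}\xi(M_{p,i+1/2}-M_{p,i-1/2})d\xi\bigr)$. Euler step: $$M_{\alpha,i}^{n*}=M_{\alpha,i}-\sigma_i\bigl(\xi M_{\alpha,i+1/2}+\delta M_{\alpha,i+1/2-}-\xi M_{\alpha,i-1/2}-\delta M_{\alpha,i-1/2+}\bigr),\quad M_{\alpha,i}^{n+1-}=M_{\alpha,i}^{n*}+\Delta t^n\bigl(N^{n+1-}_{\alpha+1/2,i}-N^{n+1-}_{\alpha-1/2,i}\bigr),$$ where $N^{n+1-}_{1/2,i}=N^{n+1-}_{N+1/2,i}=0$, $N^{n+1-}_{\alpha+1/2,i}=\frac{G_{\alpha+1/2,i}}{h_i^{n+1}}\overline M^{n+1-}_{\alpha+1/2,i}$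 with $\overline M^{n+1-}_{\alpha+1/2,i}=\overline M^{n+1-}_{\alpha,i}$ if $G_{\alpha+1/2,i}\le0$ and $=\overline M^{n+1-}_{\alpha+1,i}$ if $G_{\alpha+1/2,i}>0$; $h_i^{n+1}=\sum_\alpha\int_{\mathbb R}M^{n*}_{\alpha,i}d\xi$, $h^{n+1}_{\alpha,i}=l_\alpha h_i^{n+1}$. The intermediate state is $(\tilde h^{n+1}_{\alpha,i},\tilde h^{n+1}_{\alpha,i}\tilde u^{n+1}_{\alpha,i})=\int_{\mathbb R}(1,\xi)M^{n+1-}_{\alpha,i}d\xi$, with $\tilde h^{n+1}_{\alpha,i}=h^{n+1}_{\alpha,i}$. Viscous/friction step: the depth is unchanged, and, with $y^{1/2}=\frac{y^n+\tilde y^{n+1}}{2}$, i.e. $u^{1/2}_{\alpha,i}=\frac12(u^{n}_{\alpha,i}+\tilde u^{n+1}_{\alpha,i})$, \begin{align*} h^{n+1}_{\alpha,i}u^{n+1}_{\alpha,i}={}&\tilde h^{n+1}_{\alpha,i}\tilde u^{n+1}_{\alpha,i}+\Delta t^n\Bigl[\frac{8\mu}{\Delta x_i}\Bigl(h_{\alpha,i+1/2}\frac{u^{1/2}_{\alpha,i+1}-u^{1/2}_{\alpha,i}}{\Delta x_{i+1}+\Delta x_i}-h_{\alpha,i-1/2}\frac{u^{1/2}_{\alpha,i}-u^{1/2}_{\alpha,i-1}}{\Delta x_i+\Delta x_{i-1}}\Bigr)\\ &+2\mu\frac{u^{1/2}_{\alpha+1,i}-u^{1/2}_{\alpha,i}}{h_{\alpha+1,i}+h_{\alpha,i}}-2\mu\frac{u^{1/2}_{\alpha,i}-u^{1/2}_{\alpha-1,i}}{h_{\alpha,i}+h_{\alpha-1,i}}-\kappa\delta_{1,\alpha}u^{1/2}_{\alpha,i}\Bigr],\qquad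 \alpha=1,\dots,N, \end{align*} where $h_{\alpha,i\pm1/2}$ are interface values of the layer depth, $\delta_{1,\alpha}$ is the Kronecker symbol, and vertical difference terms involving the indices $\alpha-1=0$ or $\alpha+1=N+1$ are absent (here and in $\mathcal D_{\alpha,i}$). Entropy fluxes: $\widehat H^{n+1-}_{\alpha\pm1/2,i}=\frac{G_{\alpha\pm1/2,i}}{h^{n+1}_{i}}H(\overline M^{n+1-}_{\alpha\pm1/2,i},\xi,z_{b,i})$ (zero if $G_{\alpha\pm1/2,i}=0$), \begin{align*} \widetilde H_{\alpha,i+1/2-}={}&\xi\mathbf 1_{\xi<0}H(\overline M_{\alpha,i+1/2+},\xi,z_{b,i+1/2})+\xi\mathbf 1_{\xi>0}H(\overline M_{\alpha,i+1/2-},\xi,z_{b,i+1/2})+\xi H(\overline M_{\alpha,i},\xi,z_{b,i})-\xi H(\overline M_{\alpha,i+1/2-},\xi,z_{b,i+1/2})\\ &+\bigl(gh_i-\tfrac{u_{\alpha,i}^2}{2}+u_{\alpha,i}\xi+gz_{b,i}\bigr)\bigl(\xi\overline M_{\alpha,i+1/2-}-\xi\overline M_{\alpha,i}+\delta\overline M_{\alpha,i+1/2-}\bigr),\\ \widetilde H_{\alpha,i-1/2+}={}&\xi\mathbf 1_{\xi<0}H(\overline M_{\alpha,i-1/2+},\xi,z_{b,i-1/2})+\xi\mathbf 1_{\xi>0}H(\overline M_{\alpha,i-1/2-},\xi,z_{b,i-1/2})+\xi H(\overline M_{\alpha,i},\xi,z_{b,i})-\xi H(\overline M_{\alpha,i-1/2+},\xi,z_{b,i-1/2})\\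 &+\bigl(gh_i-\tfrac{u_{\alpha,i}^2}{2}+u_{\alpha,i}\xi+gz_{b,i}\bigr)\bigl(\xi\overline M_{\alpha,i-1/2+}-\xi\overline M_{\alpha,i}+\delta\overline M_{\alpha,i-1/2+}\bigr). \end{align*} The terms $d_{\alpha,i},e_{\alpha,i}$ (functions of $\xi$) are those of the kinetic relation for the Euler step $$H(\overline M^{n+1-}_{\alpha,i},\xi,z_{b,i})=H(\overline M_{\alpha,i},\xi,z_{b,i})-\sigma_i(\widetilde H_{\alpha,i+1/2-}-\widetilde H_{\alpha,i-1/2+})-\Delta t^n(\widehat H^{n+1-}_{\alpha+1/2,i}-\widehat H^{n+1-}_{\alpha-1/2,i})+d_{\alpha,i}+e_{\alpha,i},$$ and satisfy the estimates \begin{align*} d_{\alpha,i}\le{}&\sigma_i\xi\tfrac{g^2\pi^2}{6}\bigl(\overline M_{\alpha,i+1/2+}+2\overline M_{\alpha,i+1/2-}+\sigma_i\xi(2\overline M_{\alpha,i}+\overline M^{n*}_{\alpha,i})\bigr)(\overline M_{\alpha,i+1/2}-\overline M_{\alpha,i+1/2-})^2\\ &-\sigma_i\xi\tfrac{g^2\pi^2}{6}\bigl(\overline M_{\alpha,i-1/2-}+2\overline M_{\alpha,i-1/2+}-\sigma_i\xi(2\overline M_{\alpha,i}+\overline M^{n*}_{\alpha,i})\bigr)(\overline M_{\alpha,i-1/2}-\overline M_{\alpha,i-1/2+})^2\\ &-\Delta t^n\tfrac{g^2\pi^2}{6}\tfrac{G_{\alpha+1/2,i}}{h^{n+1}_{i}}(\overline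 M^{n+1-}_{\alpha+1/2,i}+2\overline M^{n+1-}_{\alpha,i})(\overline M^{n+1-}_{\alpha+1/2,i}-\overline M^{n+1-}_{\alpha,i})^2\\ &+\Delta t^n\tfrac{g^2\pi^2}{6}\tfrac{G_{\alpha-1/2,i}}{h^{n+1}_{i}}(\overline M^{n+1-}_{\alpha-1/2,i}+2\overline M^{n+1-}_{\alpha,i})(\overline M^{n+1-}_{\alpha-1/2,i}-\overline M^{n+1-}_{\alpha,i})^2,\\ e_{\alpha,i}\le{}&\sigma_i^2\tfrac{g^2\pi^2}{3}u_{\alpha,i}^2(2\overline M_{\alpha,i}+\overline M^{n*}_{\alpha,i})(\overline M_{\alpha,i-1/2+}-\overline M_{\alpha,i+1/2-})^2+\Delta t^n\tfrac{g^2\pi^2}{3}\tfrac{G_{\alpha+1/2,i}-G_{\alpha-1/2,i}}{h^{n+1}_{i}}(\overline M^{n+1-}_{\alpha,i})^3 . \end{align*}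
   Formalization: The midpoint is u^{1/2}=(ũ^{n+1}+u^{n+1})/2 instead of (u^n+ũ^{n+1})/2, and the integrals of H̃, Ĥ, d, e in the conclusion carry a factor l_α; as printed the inequality fails (uniform flow with friction, N=1; identical layers, N=2). *)

(* Defs.v *)
From HB Require Import structures.
From mathcomp Require Import all_boot all_order all_algebra.
From mathcomp Require Import all_classical all_reals all_analysis.

Set Implicit Arguments.
Unset Strict Implicit.
Unset Printing Implicit Defensive.

Import Order.TTheory GRing.Theory Num.Theory.
Import numFieldNormedType.Exports.

Local Open Scope ring_scope.

(* Index conventions.  Cells are indexed by i : int, and the interface i+1/2 by
   its left cell i, so i-1/2 is the interface i-1.  Layers are indexed as in
   the mathematics by a : nat with 1 <= a <= N, and the layer interface a+1/2
   by a (0 <= a <= N), so a-1/2 is the interface a.-1.  Values at layer indices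
   outside 1..N are meaningless: they occur only with the factor G_{1/2} = 0 or
   G_{N+1/2} = 0. *)

Record data (R : realType) := Data {
  grav : R;
  visc : R;                  (* mu *)
  fric : R;                  (* kappa *)
  nlay : nat;                (* N *)
  lay  : nat -> R;           (* l_a *)
  dx   : int -> R;
  dt   : R;
  zb   : int -> R;
  dep  : int -> R;           (* h_i at time n *)
  vel  : nat -> int -> R;    (* u_{a,i} at time n *)
  hint : nat -> int -> R     (* h_{a,i+1/2}, layer depth at interface i+1/2 *)
}.

Definition integ (R : realType) (f : R -> R) : R :=
  \int[@lebesgue_measure R]_(xi in setT) f xi.

Section Scheme.
Variables (R : realType) (D : data R).

Local Notation g := (grav D).
Local Notation mu := (visc D).
Local Notation kappa := (fric D).
Local Notation N := (nlay D).
Local Notation l := (lay D).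
Local Notation dx := (dx D).
Local Notation dt := (dt D).
Local Notation zb := (zb D).
Local Notation h := (dep D).
Local Notation u := (vel D).
Local Notation hint := (hint D).

Implicit Types (a : nat) (i : int) (xi : R).

Definition in_layers a := (1 <= a <= N)%N.

Definition sigma i : R := dt / dx i.

(* dt < min_{a,i} dx_i / (|u_{a,i}| + 2 sqrt (2 g h_i)), with the quotient read
   as +oo for a motionless dry cell. *)
Definition CFL : Prop := forall a i, in_layers a ->
  dt * (`|u a i| + 2 * Num.sqrt (2 * g * h i)) < dx i.

Definition maxwellian (hh uu xi : R) : R :=
  1 / (g * pi) * Num.sqrt (Num.max (2 * g * hh - (xi - uu) ^+ 2) 0).

Definition H (f xi z : R) : R :=
  xi ^+ 2 / 2 * f + g ^+ 2 * pi ^+ 2 / 6 * f ^+ 3 + g * z * f.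

Definition hlay a i : R := l a * h i.

(* Hydrostatic reconstruction; the suffixes L and R are the sides - and + of the
   interface, and "bar" is the division by l_a. *)
Definition zbI i : R := Num.max (zb i) (zb (i + 1)).
Definition hL i : R := Num.max (h i + zb i - zbI i) 0.
Definition hR i : R := Num.max (h (i + 1) + zb (i + 1) - zbI i) 0.

Definition Mbar a i xi : R := maxwellian (h i) (u a i) xi.
Definition MbarL a i xi : R := maxwellian (hL i) (u a i) xi.
Definition MbarR a i xi : R := maxwellian (hR i) (u a (i + 1)) xi.
Definition MbarI a i xi : R :=
  (0 < xi)%R%:R * MbarL a i xi + (xi < 0)%R%:R * MbarR a i xi.
(* delta Mbar_{a,i+1/2-} and delta Mbar_{a,i-1/2+} *)
Definition dMbarL a i xi : R := (xi - u a i) * (Mbar a i xi - MbarL a i xi).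
Definition dMbarR a i xi : R :=
  (xi - u a i) * (Mbar a i xi - MbarR a (i - 1) xi).

Definition M a i xi : R := l a * Mbar a i xi.
Definition MI a i xi : R := l a * MbarI a i xi.
Definition dML a i xi : R := l a * dMbarL a i xi.
Definition dMR a i xi : R := l a * dMbarR a i xi.

(* Mass exchange G_{a+1/2,i} *)
Definition netflux a i : R :=
  integ (fun xi => xi * (MI a i xi - MI a (i - 1) xi)).
Definition G a i : R :=
  if (a == 0)%N || (a == N) then 0 else
  (\sum_(1 <= j < a.+1)
     (netflux j i - l j * \sum_(1 <= p < N.+1) netflux p i)) / dx i.

Definition Mstar a i xi : R :=
  M a i xi - sigma i * (xi * MI a i xi + dML a i xi
                        - xi * MI a (i - 1) xi - dMR a i xi).
Definition Mbarstar a i xi : R := Mstar a i xi / l a.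

(* h_i^{n+1} and h_{a,i}^{n+1} *)
Definition hnew i : R := \sum_(1 <= a < N.+1) integ (Mstar a i).
Definition hlaynew a i : R := l a * hnew i.

Definition energy a i (hh uu : R) : R :=
  l a * hh / 2 * uu ^+ 2 + g / 2 * (l a * hh) * hh + g * zb i * (l a * hh).

(* Mn a i xi stands for M^{n+1-}_{a,i}(xi), which is defined implicitly. *)
Section EulerStep.
Variable Mn : nat -> int -> R -> R.

Definition Mnbar a i xi : R := Mn a i xi / l a.
(* upwind value of Mbar^{n+1-} at the layer interface a+1/2 *)
Definition Mnbarup a i xi : R :=
  if G a i <= 0 then Mnbar a i xi else Mnbar a.+1 i xi.
Definition exchange a i xi : R := G a i / hnew i * Mnbarup a i xi.

Definition Euler_step : Prop := forall a i xi, in_layers a ->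
  Mn a i xi = Mstar a i xi + dt * (exchange a i xi - exchange a.-1 i xi).

(* intermediate depth and velocity, from the moments of Mn *)
Definition htilde a i : R := integ (Mn a i).
Definition utilde a i : R := integ (fun xi => xi * Mn a i xi) / htilde a i.

(* Htilde_{a,i+1/2-} and Htilde_{a,i-1/2+} *)
Definition HtildeL a i xi : R :=
  xi * (xi < 0)%R%:R * H (MbarR a i xi) xi (zbI i)
  + xi * (0 < xi)%R%:R * H (MbarL a i xi) xi (zbI i)
  + xi * H (Mbar a i xi) xi (zb i) - xi * H (MbarL a i xi) xi (zbI i)
  + (g * h i - u a i ^+ 2 / 2 + u a i * xi + g * zb i)
    * (xi * MbarL a i xi - xi * Mbar a i xi + dMbarL a i xi).
Definition HtildeR a i xi : R :=
  xi * (xi < 0)%R%:R * H (MbarR a (i - 1) xi) xi (zbI (i - 1))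
  + xi * (0 < xi)%R%:R * H (MbarL a (i - 1) xi) xi (zbI (i - 1))
  + xi * H (Mbar a i xi) xi (zb i) - xi * H (MbarR a (i - 1) xi) xi (zbI (i - 1))
  + (g * h i - u a i ^+ 2 / 2 + u a i * xi + g * zb i)
    * (xi * MbarR a (i - 1) xi - xi * Mbar a i xi + dMbarR a i xi).
(* Hhat^{n+1-}_{a+1/2,i} *)
Definition Hhat a i xi : R := G a i / hnew i * H (Mnbarup a i xi) xi (zb i).

(* This relation is written for the barred quantities: integrating it in xi gives
   the balance of E_{a,i} / l_a, since [energy] is l_a times the integral of
   H(Mbar_{a,i}).  The balance of E_{a,i} itself is therefore l_a
   times the integrated relation. *)
Definition kinetic_relation a i (d e : R -> R) : Prop := forall xi,
  H (Mnbar a i xi) xi (zb i) =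
  H (Mbar a i xi) xi (zb i) - sigma i * (HtildeL a i xi - HtildeR a i xi)
  - dt * (Hhat a i xi - Hhat a.-1 i xi) + d xi + e xi.

Definition d_bound a i xi : R :=
  sigma i * xi * (g ^+ 2 * pi ^+ 2 / 6)
    * (MbarR a i xi + 2 * MbarL a i xi
       + sigma i * xi * (2 * Mbar a i xi + Mbarstar a i xi))
    * (MbarI a i xi - MbarL a i xi) ^+ 2
  - sigma i * xi * (g ^+ 2 * pi ^+ 2 / 6)
    * (MbarL a (i - 1) xi + 2 * MbarR a (i - 1) xi
       - sigma i * xi * (2 * Mbar a i xi + Mbarstar a i xi))
    * (MbarI a (i - 1) xi - MbarR a (i - 1) xi) ^+ 2
  - dt * (g ^+ 2 * pi ^+ 2 / 6) * (G a i / hnew i)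
    * (Mnbarup a i xi + 2 * Mnbar a i xi)
    * (Mnbarup a i xi - Mnbar a i xi) ^+ 2
  + dt * (g ^+ 2 * pi ^+ 2 / 6) * (G a.-1 i / hnew i)
    * (Mnbarup a.-1 i xi + 2 * Mnbar a i xi)
    * (Mnbarup a.-1 i xi - Mnbar a i xi) ^+ 2.

Definition e_bound a i xi : R :=
  sigma i ^+ 2 * (g ^+ 2 * pi ^+ 2 / 3) * u a i ^+ 2
    * (2 * Mbar a i xi + Mbarstar a i xi)
    * (MbarR a (i - 1) xi - MbarL a i xi) ^+ 2
  + dt * (g ^+ 2 * pi ^+ 2 / 3) * ((G a i - G a.-1 i) / hnew i)
    * Mnbar a i xi ^+ 3.

(* Semi-implicit viscous and friction step; un is u^{n+1}.  The midpoint is taken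
   between the two ends of this step, (utilde + u^{n+1}) / 2.  With
   (u^n + utilde) / 2 the step would be explicit and the energy estimate would
   fail, already for N = 1 with uniform data, flat bottom and kappa > 0. *)
Definition umid (un : nat -> int -> R) a i : R := (utilde a i + un a i) / 2.

Definition viscous_rhs (v : nat -> int -> R) a i : R :=
  8 * mu / dx i * (hint a i * ((v a (i + 1) - v a i) / (dx (i + 1) + dx i))
                   - hint a (i - 1)
                     * ((v a i - v a (i - 1)) / (dx i + dx (i - 1))))
  + (if a == N then 0 else
     2 * mu * ((v a.+1 i - v a i) / (hlay a.+1 i + hlay a i)))
  - (if a == 1%N then 0 else
     2 * mu * ((v a i - v a.-1 i) / (hlay a i + hlay a.-1 i)))
  - kappa * (a == 1%N)%:R * v a i.

Definition viscous_step (un : nat -> int -> R) : Prop :=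
  forall a i, in_layers a ->
  hlaynew a i * un a i =
  htilde a i * utilde a i + dt * viscous_rhs (umid un) a i.

End EulerStep.

(* script D_{a,i}, as a function of v = u^{1/2} *)
Definition viscous_dissip (v : nat -> int -> R) a i : R :=
  8 * mu / dx i
    * (hint a i * ((v a (i + 1) + v a i) / 2)
         * ((v a (i + 1) - v a i) / (dx (i + 1) + dx i))
       - hint a (i - 1) * ((v a i + v a (i - 1)) / 2)
         * ((v a i - v a (i - 1)) / (dx i + dx (i - 1))))
  + (if a == N then 0 else
     2 * mu * ((v a.+1 i + v a i) / 2)
       * ((v a.+1 i - v a i) / (hlay a.+1 i + hlay a i)))
  - (if a == 1%N then 0 else
     2 * mu * ((v a i + v a.-1 i) / 2)
       * ((v a i - v a.-1 i) / (hlay a i + hlay a.-1 i)))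
  - 4 * mu / dx i
    * (hint a i * ((v a (i + 1) - v a i) ^+ 2 / (dx (i + 1) + dx i))
       + hint a (i - 1) * ((v a i - v a (i - 1)) ^+ 2 / (dx i + dx (i - 1))))
  - (if a == N then 0 else
     mu * ((v a.+1 i - v a i) ^+ 2 / (hlay a.+1 i + hlay a i)))
  - (if a == 1%N then 0 else
     mu * ((v a i - v a.-1 i) ^+ 2 / (hlay a i + hlay a.-1 i)))
  - kappa * (a == 1%N)%:R * v a i ^+ 2.

End Scheme.

(* Main.v *)
Require Import Defs.
From HB Require Import structures.
From mathcomp Require Import all_boot all_order all_algebra.
From mathcomp Require Import all_classical all_reals all_analysis.
From mathcomp Require Import measurable_realfun.
From mathcomp Require Import ring lra.

Import Order.TTheory GRing.Theory Num.Theory.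
Import numFieldNormedType.Exports.

Local Open Scope ring_scope.

(** The energy of a layer is, up to the factor l_a, the integral in xi of the
    kinetic entropy of its Maxwellian, and a Maxwellian minimises that integral
    among nonnegative densities with the same mass and momentum.  Integrating
    the kinetic relation therefore turns the integral of H(Mbar) at time n into
    the energy at time n, and bounds the energy of the intermediate state
    (hnew, utilde) from above: this is the estimate for the Euler step.  The
    viscous step changes only the velocity, and multiplying it by the midpoint
    velocity (utilde + u^{n+1}) / 2 gives the change of kinetic energy exactly:
    it is dt times the dissipation, by the identity
    v (w - v) = (w + v)(w - v)/2 - (w - v)^2/2 applied to each difference.

    Two facts about the implicitly defined density Mn are needed to run this:
    it is nonnegative, and its mass is l_a times hnew.  Both are properties of
    the linear system coupling the layers.  Because the exchange terms are
    upwinded and cancel in the sum over layers, that system is an M-matrix,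
    diagonally dominant by columns: nonnegative data give nonnegative solutions
    ([upwind_op_ge0]), hence solutions are unique and depend linearly on the
    data ([upwind_op_inverse]).  Under the CFL condition the data Mstar are
    nonnegative ([Mstar_ge0]).  The constant depth hnew solves the integrated
    system ([upwind_op_hnew]), so by uniqueness it is the mass of every
    Mn / l_a ([integ_Mnbar]).  Linear dependence on the data moreover makes Mn
    a finite combination of Maxwellians multiplied by polynomials in xi and
    indicators of half-lines, which settles its measurability and
    integrability.

    The minimisation ([kinetic_entropy_min]) is convexity of H in its first
    argument: the slope of H at the Maxwellian is affine in xi on the support, so
    the first-order term integrates to zero when mass and momentum agree.  The moments of Maxwellians are computed by the substitution
    xi = u + s sin t, with s = sqrt (2 g h), which opens the square root. *)

(** * Bounded densities of compact support *)

(** A single constant bounds both the values and the support.  All densities and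
    kinetic fluxes of the scheme are of this kind, and the class is stable
    under the algebra in which they are written, so that integrability never
    has to be discussed case by case. *)
Definition tame {R : realType} (f : R -> R) : Prop :=
  measurable_fun [set: R] f /\
  exists B, forall x, `|f x| <= B /\ (B < `|x| -> f x = 0).

(** Multipliers that preserve [tame], such as polynomials in xi and the indicators
    of the two half-lines used for upwinding. *)
Definition mild {R : realType} (f : R -> R) : Prop :=
  measurable_fun [set: R] f /\
  forall B, exists C, forall x, `|x| <= B -> `|f x| <= C.

Section TameFunctions.
Context {R : realType}.
Implicit Types (f g : R -> R) (r : R).
Local Notation leb := (@lebesgue_measure R).

Lemma tame_mild f : tame f -> mild f.
Proof. by move=> [mf [B Bf]]; split=> // C; exists B => x _; case: (Bf x). Qed.

Lemma mild_cst r : mild (fun _ : R => r).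
Proof. by split=> [|B]; [exact: measurable_cst | exists `|r|]. Qed.

Lemma mild_id : mild (fun x : R => x).
Proof. by split=> [|B]; [exact: measurable_id | exists B]. Qed.

Lemma mildD f g : mild f -> mild g -> mild (fun x => f x + g x).
Proof.
move=> [mf bf] [mg bg]; split=> [|B]; first exact: measurable_funD.
have [C fC] := bf B; have [E gE] := bg B; exists (C + E) => x xB.
by rewrite (le_trans (ler_normD _ _))// lerD ?fC ?gE.
Qed.

Lemma mildM f g : mild f -> mild g -> mild (fun x => f x * g x).
Proof.
move=> [mf bf] [mg bg]; split=> [|B]; first exact: measurable_funM.
have [C fC] := bf B; have [E gE] := bg B; exists (C * E) => x xB.
by rewrite normrM ler_pM ?fC ?gE.
Qed.

Lemma mildN f : mild f -> mild (fun x => - f x).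
Proof.
move=> mf; have := mildM _ _ (mild_cst (-1)) mf.
by congr mild; apply/funext => x; rewrite mulN1r.
Qed.

Lemma mildX f n : mild f -> mild (fun x => f x ^+ n).
Proof.
move=> mf; elim: n => [|n IHn]; first exact: mild_cst.
have := mildM _ _ mf IHn.
by congr mild; apply/funext => x; rewrite exprS.
Qed.

Lemma mild_pos : mild (fun x : R => (0 < x)%R%:R).
Proof.
split=> [|B]; last by exists 1 => x _; case: (0 < x); rewrite ?normr1 ?normr0.
have -> : (fun x : R => (0 < x)%R%:R) = (\1_(`]0, +oo[%classic) : R -> R).
  by apply/funext => x; rewrite indicE mem_setE in_itv/= andbT.
exact: measurable_indic.
Qed.

Lemma mild_neg : mild (fun x : R => (x < 0)%R%:R).
Proof.
split=> [|B]; last by exists 1 => x _; case: (x < 0); rewrite ?normr1 ?normr0.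
have -> : (fun x : R => (x < 0)%R%:R) = (\1_(`]-oo, 0[%classic) : R -> R).
  by apply/funext => x; rewrite indicE mem_setE in_itv/=.
exact: measurable_indic.
Qed.

Lemma tameM f g : mild f -> tame g -> tame (fun x => f x * g x).
Proof.
move=> [mf bf] [mg [B gB]]; split; first exact: measurable_funM.
have [C fC] := bf B; exists (Num.max B (C * B)) => x.
have [xB|Bx] := leP `|x| B.
  split; last by rewrite gt_max ltNge xB.
  by rewrite le_max normrM orbC ler_pM ?fC//; case: (gB x).
have B0 : 0 <= B by case: (gB 0) => [/(le_trans (normr_ge0 _))].
by case: (gB x) => _ -> //; rewrite mulr0 normr0 le_max B0.
Qed.

Lemma tameMr f g : tame f -> mild g -> tame (fun x => f x * g x).
Proof.
move=> tf mg; have := tameM _ _ mg tf.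
by congr tame; apply/funext => x; rewrite mulrC.
Qed.

Lemma tameD f g : tame f -> tame g -> tame (fun x => f x + g x).
Proof.
move=> [mf [B fB]] [mg [C gC]]; split; first exact: measurable_funD.
have B0 : 0 <= B by case: (fB 0) => [/(le_trans (normr_ge0 _))].
have C0 : 0 <= C by case: (gC 0) => [/(le_trans (normr_ge0 _))].
exists (B + C) => x; have [fb f0] := fB x; have [gb g0] := gC x; split.
  by rewrite (le_trans (ler_normD _ _))// lerD.
by move=> BCx; rewrite f0 ?g0 ?addr0//; lra.
Qed.

Lemma tameN f : tame f -> tame (fun x => - f x).
Proof.
move=> tf; have := tameM _ _ (mild_cst (-1)) tf.
by congr tame; apply/funext => x; rewrite mulN1r.
Qed.

Lemma tameX f n : tame f -> tame (fun x => f x ^+ n.+1).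
Proof.
move=> tf; have := tameMr _ _ tf (mildX _ n (tame_mild _ tf)).
by congr tame; apply/funext => x; rewrite exprS.
Qed.

Lemma tame_sum (m n : nat) (F : nat -> R -> R) :
  (forall k, (m <= k < n)%N -> tame (F k)) ->
  tame (fun x => \sum_(m <= k < n) F k x).
Proof.
move=> tF; have -> : (fun x => \sum_(m <= k < n) F k x) =
    (fun x => \sum_(k <- index_iota m n | (m <= k < n)%N) F k x).
  by apply/funext => x; rewrite -big_nat.
elim: (index_iota m n) => [|k s IHs].
  have -> : (fun x => \sum_(k <- [::] | (m <= k < n)%N) F k x) = (fun=> 0).
    by apply/funext => x; rewrite big_nil.
  by split; [exact: measurable_cst | exists 0 => x; rewrite normr0].
have [kmn|kmn] := boolP (m <= k < n)%N; last first.
  by move: IHs; congr tame; apply/funext => x; rewrite big_cons (negbTE kmn).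
have := tameD _ _ (tF k kmn) IHs.
by congr tame; apply/funext => x; rewrite big_cons kmn.
Qed.

Lemma tame_integrable f : tame f -> leb.-integrable [set: R] (EFin \o f).
Proof.
move=> [mf [B fB]].
have fE : EFin \o f = (EFin \o f) \_ `[- B, B].
  apply/funext => x; rewrite patchE; case: ifPn => //.
  rewrite mem_setE in_itv/= -ler_norml -ltNge => /(fB x).2 /= fx.
  by rewrite fx.
rewrite fE; apply/(integrable_mkcond _ _).1 => //.
apply: measurable_bounded_integrable => //.
- by rewrite /= lebesgue_measure_itv/=; case: ifP => _; rewrite ?ltry.
- exact: measurable_funS mf.
- exists B; split; first exact: num_real.
  by move=> C BC x _; case: (fB x) => fx _; rewrite /= (le_trans fx)// ltW.
Qed.

Lemma integD f g : leb.-integrable [set: R] (EFin \o f) ->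
  leb.-integrable [set: R] (EFin \o g) ->
  integ (fun x => f x + g x) = integ f + integ g.
Proof. by move=> ? ?; rewrite /integ RintegralD. Qed.

Lemma integB f g : leb.-integrable [set: R] (EFin \o f) ->
  leb.-integrable [set: R] (EFin \o g) ->
  integ (fun x => f x - g x) = integ f - integ g.
Proof. by move=> ? ?; rewrite /integ RintegralB. Qed.

Lemma integZ f r : leb.-integrable [set: R] (EFin \o f) ->
  integ (fun x => r * f x) = r * integ f.
Proof. by move=> ?; rewrite /integ RintegralZl. Qed.

Lemma le_integ f g : leb.-integrable [set: R] (EFin \o f) ->
  leb.-integrable [set: R] (EFin \o g) ->
  (forall x, f x <= g x) -> integ f <= integ g.
Proof. by move=> ? ? fg; apply: le_Rintegral. Qed.

Lemma integ0 : integ (fun _ : R => 0) = 0.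
Proof. by rewrite /integ Rintegral_cst// mul0r. Qed.

Lemma integ_sum (m n : nat) (F : nat -> R -> R) :
  (forall k, (m <= k < n)%N -> tame (F k)) ->
  integ (fun x => \sum_(m <= k < n) F k x) = \sum_(m <= k < n) integ (F k).
Proof.
have [nm _|mn] := leqP n m.
  rewrite big_geq// -[RHS]integ0; congr integ; apply/funext => x.
  by rewrite big_geq.
elim: n mn => // n IHn; rewrite ltnS leq_eqVlt => /orP[/eqP -> tF|mn tF].
  by rewrite big_nat1; congr integ; apply/funext => x; rewrite big_nat1.
rewrite big_nat_recr/= 1?ltnW// -IHn//; last first.
  by move=> k /andP[mk kn]; apply: tF; rewrite mk ltnW.
rewrite -integD.
- by congr integ; apply/funext => x; rewrite big_nat_recr/= 1?ltnW.
- apply/tame_integrable/tame_sum => k /andP[mk kn].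
  by apply: tF; rewrite mk ltnW.
- by apply/tame_integrable/tF; rewrite ltnSn ltnW.
Qed.

End TameFunctions.

Ltac solve_mild := first
  [ assumption | exact: mild_cst | exact: mild_id | exact: mild_pos
  | exact: mild_neg | (apply: mildX; solve_mild) | (apply: mildN; solve_mild)
  | (apply: mildD; solve_mild) | (apply: mildM; solve_mild) ].
Ltac solve_tame := first
  [ assumption | (apply: tameX; solve_tame)
  | (apply: tameN; solve_tame) | (apply: tameD; solve_tame)
  | (apply: tameM; [solve_mild | solve_tame])
  | (apply: tameMr; [solve_tame | solve_mild]) ].

Lemma integZB {R : realType} (f g : R -> R) r : tame f -> tame g ->
  integ (fun x => r * (f x - g x)) = r * (integ f - integ g).
Proof.
move=> tf tg; rewrite integZ; last by apply/tame_integrable; solve_tame.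
by congr (_ * _); apply: integB; exact: tame_integrable.
Qed.

Lemma integ_idZ {R : realType} (f : R -> R) r : tame f ->
  integ (fun xi => r * (xi * f xi)) = r * integ (fun xi => xi * f xi).
Proof. by move=> tf; rewrite integZ//; apply/tame_integrable; solve_tame. Qed.

(** * Moments of Maxwellians *)

(** Integration over a semicircle: the substitution x = u + s sin t maps
    [-pi/2, pi/2] onto the support of f, and T is a primitive of the result. *)
Lemma integ_sin_substitution {R : realType} (u s : R) (f T : R -> R) :
  0 < s -> continuous f ->
  (forall x, s < `|x - u| -> f x = 0) ->
  (forall t, - (pi / 2) <= t <= pi / 2 ->
     is_derive t (1 : R) T (f (u + s * sin t) * (s * cos t))) ->
  integ f = T (pi / 2) - T (- (pi / 2)).
Proof.
move=> s_gt0 cf f0 T'.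
have pi2 : - (pi / 2) < pi / 2 :> R by have := pi_gt0 R; lra.
pose F t : R := u + s * sin t.
have F' t : is_derive t (1 : R) F (s * cos t).
  by apply: is_derive_eq; rewrite /GRing.scale/=; ring.
have F'E : derive1 F = fun t => s * cos t.
  by apply/funext => t; rewrite derive1E; exact: derive_val.
have cF' : continuous (derive1 F).
  rewrite F'E => t; apply: cvgM; [exact: cvg_cst | exact: continuous_cos].
have FE1 : F (pi / 2) = u + s by rewrite /F sin_pihalf mulr1.
have FE2 : F (- (pi / 2)) = u - s by rewrite /F sinN sin_pihalf mulrN mulr1.
have cF : continuous F.
  by move=> t; apply/differentiable_continuous/derivable1_diffP; case: (F' t).
have dF : derivable_oo_LRcontinuous F (- (pi / 2)) (pi / 2).
  split; first by move=> t _; case: (F' t).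
  - exact/cvg_at_right_filter/cF.
  - exact/cvg_at_left_filter/cF.
pose leb := @lebesgue_measure R.
have subst : (\int[leb]_(x in `[F (- (pi / 2))%R, F (pi / 2)%R]) (f x)%:E =
    \int[leb]_(x in `[(- (pi / 2))%R, (pi / 2)%R])
      (((f \o F) * derive1 F)%R x)%:E)%E.
  apply: integration_by_substitution_increasing => //; first exact: ltW.
  - move=> x y xI yI xy; rewrite /F ltrD2l ltr_pM2l//.
    by rewrite ltr_sin.
  - by apply/cvg_ex; exists (derive1 F (- (pi/2))); exact/cvg_at_right_filter/cF'.
  - by apply/cvg_ex; exists (derive1 F (pi/2)); exact/cvg_at_left_filter/cF'.
  - exact: continuous_subspaceT.
rewrite /integ.
have -> : \int[leb]_x f x = \int[leb]_(x in `[F (- (pi / 2)), F (pi / 2)]) f x.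
  rewrite [RHS]Rintegral_mkcond; congr Rintegral; apply/funext => x.
  rewrite patchE; case: ifPn => //.
  rewrite mem_setE in_itv/= FE1 FE2 => xs; apply: f0.
  by rewrite ltNge; apply: contra xs; rewrite ler_norml; lra.
rewrite /Rintegral subst; have cT t : - (pi / 2) <= t <= pi / 2 ->
    {for t, continuous T}.
  by move=> tI; apply/differentiable_continuous/derivable1_diffP; case: (T' t tI).
rewrite (@continuous_FTC2 _ _ T)//=.
- apply: continuous_subspaceT => t; apply: cvgM; last exact: cF'.
  by apply: (@continuous_comp _ _ _ F f); [exact: cF | exact: cf].
- split.
  + move=> t /itvP tI; have tI' : - (pi / 2) <= t <= pi / 2 by rewrite !tI.
    by case: (T' t tI').
  + by apply/cvg_at_right_filter/cT; lra.
  + by apply/cvg_at_left_filter/cT; lra.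
- move=> t /itvP tI; rewrite derive1E /= F'E.
  have tI' : - (pi / 2) <= t <= pi / 2 by rewrite !tI.
  by have [_ ->] := T' t tI'.
Qed.

Section Maxwellian.
Context {R : realType} (D : data R).
Hypothesis grav_gt0 : 0 < grav D.
Local Notation g := (grav D).

Lemma maxwellian_ge0 hh uu xi : 0 <= maxwellian D hh uu xi.
Proof.
by rewrite /maxwellian mulr_ge0 ?sqrtr_ge0// divr_ge0// mulr_ge0 ?pi_ge0// ltW.
Qed.

Lemma le_maxwellian hh hh' uu xi : hh <= hh' ->
  maxwellian D hh uu xi <= maxwellian D hh' uu xi.
Proof.
move=> hhh'; rewrite /maxwellian ler_wpM2l//.
  by rewrite divr_ge0// mulr_ge0 ?pi_ge0// ltW.
rewrite ler_wsqrtr// ge_max !le_max lexx orbT andbT lerD2r.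
by rewrite ler_wpM2l ?mulr_ge0// ltW.
Qed.

Lemma maxwellian_out hh uu xi : 2 * g * hh <= (xi - uu) ^+ 2 ->
  maxwellian D hh uu xi = 0.
Proof.
by move=> out; rewrite /maxwellian max_r ?sqrtr0 ?mulr0// subr_le0.
Qed.

Lemma maxwellian_in hh uu xi : (xi - uu) ^+ 2 <= 2 * g * hh ->
  (g * pi * maxwellian D hh uu xi) ^+ 2 = 2 * g * hh - (xi - uu) ^+ 2.
Proof.
move=> xi_in; rewrite /maxwellian max_l ?subr_ge0// mulrA mulrA mulr1 divff.
  by rewrite mul1r sqr_sqrtr ?subr_ge0.
by rewrite mulf_neq0 ?(gt_eqF (pi_gt0 R)) ?(gt_eqF grav_gt0).
Qed.

Lemma maxwellian0 uu xi : maxwellian D 0 uu xi = 0.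
Proof. by apply: maxwellian_out; rewrite mulr0 sqr_ge0. Qed.

Lemma continuous_maxwellian hh uu : continuous (maxwellian D hh uu).
Proof.
move=> xi; rewrite /maxwellian; apply: cvgM; first exact: cvg_cst.
apply: (@continuous_comp _ _ _ (fun xi : R => Num.max (2 * g * hh - (xi - uu) ^+ 2) 0));
  last exact: sqrt_continuous.
apply: continuous_max; last exact: cvg_cst.
apply: cvgB; first exact: cvg_cst.
apply: (@continuous_comp _ _ _ (fun xi : R => xi - uu) (fun x : R => x ^+ 2)).
  by apply: cvgB; [exact: cvg_id | exact: cvg_cst].
exact: exprn_continuous.
Qed.

Lemma maxwellian_far hh uu xi : Num.sqrt (2 * g * hh) < `|xi - uu| ->
  maxwellian D hh uu xi = 0.
Proof.
move=> far; apply: maxwellian_out; rewrite -real_normK ?num_real//.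
have [h0|h0] := leP 0 (2 * g * hh); last by rewrite (le_trans (ltW h0))// sqr_ge0.
by rewrite -[leLHS]sqr_sqrtr// lerXn2r// ?nnegrE ?sqrtr_ge0// ltW.
Qed.

Lemma tame_maxwellian hh uu : tame (maxwellian D hh uu).
Proof.
split; first by apply: continuous_measurable_fun => xi; exact: continuous_maxwellian.
pose s := Num.sqrt (2 * g * hh).
have s_ge0 : 0 <= s by rewrite sqrtr_ge0.
exists (s + `|uu| + (1 / (g * pi)) * s) => xi.
have k_ge0 : 0 <= 1 / (g * pi) by rewrite divr_ge0// mulr_ge0 ?pi_ge0// ltW.
have kh_ge0 := mulr_ge0 k_ge0 s_ge0.
split; last first.
  move=> far; apply: maxwellian_far; rewrite -/s.
  have := lerB_dist xi uu; lra.
rewrite ger0_norm ?maxwellian_ge0//.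
apply: (@le_trans _ _ (1 / (g * pi) * s)); last by have := normr_ge0 uu; lra.
rewrite /maxwellian ler_wpM2l// /s.
have [h0|h0] := leP 0 (2 * g * hh).
  by rewrite ler_wsqrtr// ge_max h0 andbT gerBl sqr_ge0.
rewrite max_r ?sqrtr0 ?sqrtr_ge0//.
by have := sqr_ge0 (xi - uu); lra.
Qed.

(** In the variable t the square root of the Maxwellian becomes s cos t, since
    cos t >= 0 on [-pi/2, pi/2]. *)
Lemma maxwellian_arcsin hh uu t : 0 <= hh -> - (pi / 2) <= t <= pi / 2 ->
  maxwellian D hh uu (uu + Num.sqrt (2 * g * hh) * sin t) =
  (g * pi)^-1 * (Num.sqrt (2 * g * hh) * cos t).
Proof.
move=> h0 tI; have gh0 : 0 <= 2 * g * hh by rewrite !mulr_ge0// ltW.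
rewrite /maxwellian div1r [uu + _]addrC addrK; congr (_ * _).
rewrite exprMn sqr_sqrtr// sin2cos2 mulrBr mulr1 opprB addrC subrK max_l.
  by rewrite sqrtrM// sqrtr_sqr ger0_norm// cos_ge0_pihalf.
by rewrite mulr_ge0 ?sqr_ge0.
Qed.

Lemma integ_maxwellian hh uu : 0 <= hh -> integ (maxwellian D hh uu) = hh.
Proof.
rewrite le_eqVlt => /predU1P[<-|h0].
  by rewrite -[RHS](@integ0 R); congr integ; apply/funext => xi; exact: maxwellian0.
pose s := Num.sqrt (2 * g * hh).
have s_gt0 : 0 < s by rewrite sqrtr_gt0 !mulr_gt0.
pose T (t : R) := (g * pi)^-1 * (s * s) * ((t + sin t * cos t) / 2).
transitivity (T (pi / 2) - T (- (pi / 2))); first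
  apply: (integ_sin_substitution uu s) => //.
  - exact: continuous_maxwellian.
  - by move=> xi; exact: maxwellian_far.
  - move=> t tI; rewrite maxwellian_arcsin// 1?ltW// -/s /T.
    apply: is_derive_eq; rewrite /GRing.scale/=.
    have := cos2Dsin2 t; set C := cos t; set S := sin t; set k := _^-1 => cs.
    (* Both sides agree modulo cos^2 + sin^2 = 1; the cofactor is explicit. *)
    apply/subr0_eq; rewrite (_ : _ - _ = k * s * s / 2 * (1 - (C ^+ 2 + S ^+ 2))).
      by rewrite cs subrr mulr0.
    by field.
rewrite /T sinN cosN !cos_pihalf sin_pihalf -expr2 /s sqr_sqrtr.
  by move: (pi : R) (pi_gt0 R) => p p_gt0; field; rewrite !gt_eqF.
by rewrite !mulr_ge0// ltW.
Qed.

(** This is why the correction terms delta M carry no mass: they are differences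
    of two Maxwellians centred at the same velocity. *)
Lemma integ_centered_maxwellian hh uu : 0 <= hh ->
  integ (fun xi => (xi - uu) * maxwellian D hh uu xi) = 0.
Proof.
rewrite le_eqVlt => /predU1P[<-|h0].
  rewrite -[RHS](@integ0 R); congr integ; apply/funext => xi.
  by rewrite maxwellian0 mulr0.
pose s := Num.sqrt (2 * g * hh).
have s_gt0 : 0 < s by rewrite sqrtr_gt0 !mulr_gt0.
pose T (t : R) := - (g * pi)^-1 * (s * s * s) * (cos t * cos t * cos t / 3).
transitivity (T (pi / 2) - T (- (pi / 2))); first
  apply: (integ_sin_substitution uu s) => //.
  - move=> xi; apply: cvgM; last exact: continuous_maxwellian.
    by apply: cvgB; [exact: cvg_id | exact: cvg_cst].
  - by move=> xi far; rewrite maxwellian_far ?mulr0.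
  - move=> t tI; rewrite maxwellian_arcsin// 1?ltW// -/s /T.
    apply: is_derive_eq; rewrite /GRing.scale/=.
    by set k := _^-1; field.
by rewrite /T cosN subrr.
Qed.

(** The thermal and the cubic part of the entropy each contribute g h^2 / 4;
    together they are the potential energy of the water column. *)
Lemma integ_internal_maxwellian hh uu : 0 <= hh ->
  integ (fun xi => (xi - uu) ^+ 2 / 2 * maxwellian D hh uu xi
    + g ^+ 2 * pi ^+ 2 / 6 * maxwellian D hh uu xi ^+ 3) = g / 2 * hh ^+ 2.
Proof.
rewrite le_eqVlt => /predU1P[<-|h0].
  rewrite expr0n mulr0 -[RHS](@integ0 R); congr integ; apply/funext => xi.
  by rewrite maxwellian0 expr0n/= !mulr0 addr0.
pose s := Num.sqrt (2 * g * hh).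
have s_gt0 : 0 < s by rewrite sqrtr_gt0 !mulr_gt0.
pose T (t : R) := (g * pi)^-1 * (s * s * s * s)
  * (t / 8 + sin t * cos t / 8 - sin t * cos t * cos t * cos t / 12).
have gpi : g * pi != 0 by rewrite mulf_neq0 ?(gt_eqF (pi_gt0 R)) ?(gt_eqF grav_gt0).
transitivity (T (pi / 2) - T (- (pi / 2))); first
  apply: (integ_sin_substitution uu s) => //.
  - move=> xi; have cM := continuous_maxwellian hh uu xi; apply: cvgD; apply: cvgM => //.
    + apply: cvgM; last exact: cvg_cst.
      apply: (@continuous_comp _ _ _ (fun xi : R => xi - uu) (fun x : R => x ^+ 2)).
        by apply: cvgB; [exact: cvg_id | exact: cvg_cst].
      exact: exprn_continuous.
    + exact: cvg_cst.
    + apply: (@continuous_comp _ _ _ (maxwellian D hh uu) (fun x : R => x ^+ 3)) => //.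
      exact: exprn_continuous.
  - by move=> xi far; rewrite maxwellian_far// expr0n !mulr0 addr0.
  - move=> t tI; rewrite maxwellian_arcsin// 1?ltW// -/s /T.
    apply: is_derive_eq; rewrite /GRing.scale/=.
    have gpi2 : g ^+ 2 * pi ^+ 2 = (g * pi) ^+ 2 by ring.
    rewrite gpi2; move: gpi; set q := g * pi => q0.
    have := cos2Dsin2 t; set C := cos t; set S := sin t => cs.
    apply/subr0_eq; rewrite (_ : _ - _ =
      q^-1 * s ^+ 4 * (1 / 8 + C ^+ 2 / 4) * (1 - (C ^+ 2 + S ^+ 2))).
      by rewrite cs subrr mulr0.
    by field.
rewrite /T sinN cosN !cos_pihalf sin_pihalf.
have s2 : s * s = 2 * g * hh by rewrite -expr2 sqr_sqrtr// !mulr_ge0// ltW.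
have -> : s * s * s * s = (2 * g * hh) ^+ 2 by rewrite -s2; ring.
by move: (pi : R) (pi_gt0 R) => p p_gt0; field; rewrite !gt_eqF.
Qed.

End Maxwellian.

(** * Minimisation of the kinetic entropy *)

Section KineticEntropy.
Context {R : realType} (D : data R).
Hypothesis grav_gt0 : 0 < grav D.
Local Notation g := (grav D).

Lemma tame_H f z : tame f -> tame (fun xi => H D (f xi) xi z).
Proof. by move=> tf; rewrite /H; solve_tame. Qed.

Lemma integ_id_maxwellian hh uu : 0 <= hh ->
  integ (fun xi => xi * maxwellian D hh uu xi) = hh * uu.
Proof.
move=> h0; pose M := maxwellian D hh uu; have tM : tame M by exact: tame_maxwellian.
have -> : (fun xi => xi * M xi) = (fun xi => (xi - uu) * M xi + uu * M xi).
  by apply/funext => xi; ring.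
rewrite integD; [|by apply/tame_integrable; solve_tame..].
rewrite integZ; last exact: tame_integrable.
by rewrite /M integ_centered_maxwellian// integ_maxwellian// add0r mulrC.
Qed.

Lemma integ_H_maxwellian hh uu z : 0 <= hh ->
  integ (fun xi => H D (maxwellian D hh uu xi) xi z) =
  hh / 2 * uu ^+ 2 + g / 2 * hh * hh + g * z * hh.
Proof.
move=> h0; pose M := maxwellian D hh uu; have tM : tame M by exact: tame_maxwellian.
have -> : (fun xi => H D (M xi) xi z) = (fun xi =>
    ((xi - uu) ^+ 2 / 2 * M xi + g ^+ 2 * pi ^+ 2 / 6 * M xi ^+ 3)
    + (uu * (xi * M xi) + (g * z - uu ^+ 2 / 2) * M xi)).
  by apply/funext => xi; rewrite /H; move: (pi : R) => p; field.
rewrite integD; [|by apply/tame_integrable; solve_tame..].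
rewrite [X in _ + X]integD; [|by apply/tame_integrable; solve_tame..].
rewrite (integ_idZ M uu tM) (integZ M); last exact: tame_integrable.
rewrite /M integ_internal_maxwellian// integ_id_maxwellian// integ_maxwellian//.
by field.
Qed.

(** Inside the support (g pi M)^2 = 2 g h - (xi - u)^2, so the slope of H at M is
    the affine function of xi displayed, and the gap is a multiple of
    (f - M)^2 (f + 2 M).  Outside the support M = 0 and the slope of the linear
    part of H is at least the affine function. *)
Lemma H_above_tangent hh uu z f xi : 0 <= f ->
  H D (maxwellian D hh uu xi) xi z
    + (g * hh - uu ^+ 2 / 2 + uu * xi + g * z) * (f - maxwellian D hh uu xi)
  <= H D f xi z.
Proof.
move=> f0; rewrite /H.
have [out|inn] := leP (2 * g * hh) ((xi - uu) ^+ 2).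
  rewrite maxwellian_out// expr0n/= !mulr0 !add0r subr0.
  have : 0 <= g ^+ 2 * pi ^+ 2 / 6 * f ^+ 3.
    by rewrite mulr_ge0 ?exprn_ge0// divr_ge0// mulr_ge0 ?sqr_ge0.
  move: (pi : R) => p p0; nra.
have := maxwellian_in D grav_gt0 hh uu xi (ltW inn).
have := maxwellian_ge0 D grav_gt0 hh uu xi.
set M := maxwellian _ _ _ _; move: (pi : R) => p M0 M2.
rewrite -subr_ge0.
have -> : xi ^+ 2 / 2 * f + g ^+ 2 * p ^+ 2 / 6 * f ^+ 3 + g * z * f -
    (xi ^+ 2 / 2 * M + g ^+ 2 * p ^+ 2 / 6 * M ^+ 3 + g * z * M +
     (g * hh - uu ^+ 2 / 2 + uu * xi + g * z) * (f - M)) =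
    (g * p) ^+ 2 / 6 * ((f - M) ^+ 2 * (f + 2 * M))
    + (f - M) / 2 * ((g * p * M) ^+ 2 - (2 * g * hh - (xi - uu) ^+ 2)) by field.
rewrite M2 subrr mulr0 addr0 mulr_ge0 ?divr_ge0 ?sqr_ge0//.
by rewrite mulr_ge0 ?sqr_ge0// addr_ge0// mulr_ge0.
Qed.

(** The tangent correction is a combination of f - M and xi (f - M), whose
    integrals vanish because f and M share their first two moments. *)
Lemma kinetic_entropy_min f hh uu z : tame f -> (forall xi, 0 <= f xi) ->
  0 <= hh -> integ f = hh -> integ (fun xi => xi * f xi) = hh * uu ->
  hh / 2 * uu ^+ 2 + g / 2 * hh * hh + g * z * hh <=
  integ (fun xi => H D (f xi) xi z).
Proof.
move=> tf f0 h0 fh fhu; pose M := maxwellian D hh uu.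
have tM : tame M by exact: tame_maxwellian.
have tH : tame (fun xi => H D (M xi) xi z) by exact: tame_H.
pose k := g * hh - uu ^+ 2 / 2 + g * z.
pose t xi := H D (M xi) xi z +
  ((k * f xi - k * M xi) + (uu * (xi * f xi) - uu * (xi * M xi))).
have -> : hh / 2 * uu ^+ 2 + g / 2 * hh * hh + g * z * hh = integ t.
  have mass : integ (fun xi => k * f xi - k * M xi) = 0.
    rewrite integB; [|by apply/tame_integrable; solve_tame..].
    rewrite (integZ f k (tame_integrable f tf)) (integZ M k (tame_integrable M tM)).
    by rewrite fh /M integ_maxwellian// subrr.
  have momentum : integ (fun xi => uu * (xi * f xi) - uu * (xi * M xi)) = 0.
    rewrite integB; [|by apply/tame_integrable; solve_tame..].
    rewrite (integ_idZ f uu tf) (integ_idZ M uu tM).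
    by rewrite fhu /M integ_id_maxwellian// subrr.
  rewrite integD; [|by apply/tame_integrable; solve_tame..].
  rewrite [X in _ = _ + X]integD; [|by apply/tame_integrable; solve_tame..].
  by rewrite mass momentum /M integ_H_maxwellian// !addr0.
apply: le_integ.
- by apply/tame_integrable; rewrite /t; solve_tame.
- exact/tame_integrable/tame_H.
- move=> xi; apply: le_trans (H_above_tangent hh uu z (f xi) xi (f0 xi)).
  by rewrite /t /k -/M le_eqVlt; apply/orP; left; apply/eqP; ring.
Qed.

End KineticEntropy.

(** * The upwind exchange system *)

(** The exchange through the interface above layer a takes the value of the layer
    the water comes from; c a is the rate of exchange through it. *)
Definition upwind {R : realType} (c x : nat -> R) (a : nat) : R :=
  if c a <= 0 then x a else x a.+1.

(** The matrix of the implicit exchange between layers; its right-hand side is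
    the density before the exchange. *)
Definition upwind_op {R : realType} (l c x : nat -> R) (a : nat) : R :=
  l a * x a - (c a * upwind c x a - c a.-1 * upwind c x a.-1).

(** The discrete Kato argument: test the equations with the indicator s of
    {x < 0}.  By upwinding, the flux F satisfies F a * (s a - s a.+1) >= 0, and
    it vanishes at the bottom and at the surface, so summation by parts shows
    that the sum of l a * x a over {x < 0} is nonnegative; its terms being
    negative, {x < 0} is empty. *)
Lemma upwind_op_ge0 {R : realType} (N : nat) (l c x : nat -> R) :
  (forall a, (1 <= a <= N)%N -> 0 < l a) -> c 0%N = 0 -> c N = 0 ->
  (forall a, (1 <= a <= N)%N -> 0 <= upwind_op l c x a) ->
  forall a, (1 <= a <= N)%N -> 0 <= x a.
Proof.
move=> l_gt0 c0 cN op_ge0.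
pose s a : R := (x a < 0)%R%:R.
pose F a := c a * upwind c x a.
have s01 a : (s a = 0 /\ 0 <= x a) \/ (s a = 1 /\ x a < 0).
  rewrite /s; have [xa|xa] := ltP (x a) 0; first by right.
  by left.
have Fs a : 0 <= F a * (s a - s a.+1).
  rewrite /F /upwind; have [ca|ca] := leP (c a) 0;
  case: (s01 a) => -[-> xa]; case: (s01 a.+1) => -[-> xa']; nra.
(* Summation by parts, kept as an inequality at every interface n. *)
have flux n : s n * F n <= \sum_(1 <= a < n.+1) s a * (F a - F a.-1).
  elim: n => [|n IHn]; first by rewrite big_geq// /F c0 mul0r mulr0.
  rewrite big_nat_recr//=; have := Fs n; move: IHn.
  by set S := \sum_(_ <= _ < _) _; nra.
have sum_ge0 : 0 <= \sum_(1 <= a < N.+1) s a * (l a * x a).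
  have := flux N; rewrite {1}/F cN mul0r mulr0 => /le_trans; apply.
  rewrite !big_nat; apply: ler_sum => a /= aN.
  have sa_ge0 : 0 <= s a by case: (s01 a) => -[-> _].
  by rewrite ler_wpM2l//; have := op_ge0 a aN; rewrite /upwind_op /F; lra.
have term_ge0 a : (1 <= a < N.+1)%N -> 0 <= - (s a * (l a * x a)).
  by move=> aN; have := l_gt0 a aN; case: (s01 a) => -[-> xa]; nra.
have : \sum_(1 <= a < N.+1 | (1 <= a < N.+1)%N) - (s a * (l a * x a)) == 0.
  apply/eqP/le_anti/andP; split; last exact: sumr_ge0.
  by rewrite -big_nat sumrN oppr_le0.
rewrite psumr_eq0 => [|a /term_ge0 //].
move=> /allP all0 a aN; have := all0 a; rewrite mem_index_iota aN => /(_ isT)/=.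
have := l_gt0 a aN; case: (s01 a) => -[-> xa la]; first by [].
by move=> /eqP; nra.
Qed.

(** Applied to x and to - x, positivity shows that the kernel is trivial; the
    finite system is then invertible, and w is its inverse matrix.  Having the
    inverse as fixed coefficients is what allows the system to be solved
    pointwise in xi and then integrated. *)
Lemma upwind_op_inverse {R : realType} (N : nat) (l c : nat -> R) :
  (forall a, (1 <= a <= N)%N -> 0 < l a) -> c 0%N = 0 -> c N = 0 ->
  exists w : nat -> nat -> R, forall x a, (1 <= a <= N)%N ->
    x a = \sum_(1 <= k < N.+1) w a k * upwind_op l c x k.
Proof.
move=> l_gt0 c0 cN.
have op_eq x y : (forall a, (1 <= a <= N)%N -> x a = y a) ->
    forall a, (1 <= a <= N)%N -> upwind_op l c x a = upwind_op l c y a.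
  move=> xy; have F_eq a : (a <= N)%N ->
      c a * upwind c x a = c a * upwind c y a.
    rewrite /upwind; case: a => [|a] aN; first by rewrite c0 !mul0r.
    case: ifPn => [_|ca]; first by rewrite xy.
    rewrite xy//= ltn_neqAle aN andbT.
    by apply: contra ca => /eqP ->; rewrite cN.
  move=> a /andP[a1 aN]; rewrite /upwind_op F_eq// F_eq ?xy ?a1//.
  exact: leq_trans (leq_pred _) aN.
have op_lin k x y a : upwind_op l c (fun a => k * x a + y a) a =
    k * upwind_op l c x a + upwind_op l c y a.
  by rewrite /upwind_op /upwind; case: ifP; case: ifP => _ _; ring.
(* Row vectors are extended by zero outside the layers 1..N; the operator never
   sees the extension there because c vanishes at 0 and at N. *)
pose ext (v : 'rV[R]_N) (a : nat) := \sum_(j < N) (a == j.+1)%:R * v 0 j.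
have extE v (j : 'I_N) : ext v j.+1 = v 0 j.
  rewrite /ext (bigD1 j)//= eqxx mul1r big1 ?addr0// => k kj.
  by rewrite eqSS eq_sym (inj_eq val_inj) (negbTE kj) mul0r.
have ext_lin k v w : ext (k *: v + w) =1 (fun a => k * ext v a + ext w a).
  move=> a; rewrite /ext mulr_sumr -big_split/=; apply: eq_bigr => j _.
  by rewrite !mxE; ring.
pose T (v : 'rV[R]_N) : 'rV[R]_N := \row_j upwind_op l c (ext v) j.+1.
have T_lin : linear T.
  move=> k v w; apply/rowP => j; rewrite !mxE -op_lin.
  by apply: op_eq; [move=> a _; rewrite ext_lin | rewrite /= ltn_ord].
pose TL := HB.pack_for {linear 'rV[R]_N -> 'rV[R]_N} T
  (GRing.isLinear.Build R _ _ _ T T_lin).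
pose A := lin1_mx TL.
have TA v : v *m A = T v by rewrite mul_rV_lin1.
have A_unit : A \in unitmx.
  rewrite -row_free_unit -kermx_eq0; apply/eqP/row_matrixP => k.
  rewrite row0; set v := row k _.
  have Tv0 : T v = 0 by rewrite -TA /v -row_mul mulmx_ker row0.
  have op0 a : (1 <= a <= N)%N -> upwind_op l c (ext v) a = 0.
    case: a => // a aN; have /= := congr1 (fun M : 'rV_N => M 0 (Ordinal aN)) Tv0.
    by rewrite !mxE.
  clearbody v; apply/rowP => j; rewrite [RHS]mxE -extE; apply/le_anti/andP; split;
    last first.
    by apply: (upwind_op_ge0 N l c (ext v)) => // [a /op0 ->//|]; rewrite /= ltn_ord.
  rewrite -oppr_ge0.
  apply: (upwind_op_ge0 N l c (fun a => - ext v a)) => //; last by rewrite /= ltn_ord.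
  move=> a aN; have -> : upwind_op l c (fun a => - ext v a) a =
      - upwind_op l c (ext v) a.
    by rewrite /upwind_op /upwind; case: ifP; case: ifP => _ _; ring.
  by rewrite op0// oppr0.
exists (fun a k => \sum_(i < N) \sum_(j < N)
  (k == i.+1)%:R * (a == j.+1)%:R * invmx A i j) => x a /andP[a1 aN].
case: a a1 aN => // a _ aN.
pose v : 'rV[R]_N := \row_j x j.+1.
have xE b : (1 <= b <= N)%N -> x b = ext v b.
  by case: b => // b bN; rewrite (extE v (Ordinal bN)) mxE.
have -> : x a.+1 = (T v *m invmx A) 0 (Ordinal aN).
  by rewrite -TA mulmxK// mxE.
rewrite mxE big_add1 big_mkord/=; apply: eq_bigr => i _.
rewrite (bigD1 i)//= [X in _ + X]big1 ?addr0; last first.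
  move=> j ji; apply: big1 => k _.
  by rewrite eqSS eq_sym (inj_eq val_inj) (negbTE ji) !mul0r.
rewrite (bigD1 (Ordinal aN))//= big1 ?addr0; last first.
  move=> j ji; rewrite [X in _ * X * _](_ : _ = 0) ?mulr0 ?mul0r//.
  by rewrite eqSS; case: eqP => // aj; case/eqP: ji; apply/val_inj.
rewrite !eqxx !mul1r mulrC; congr (_ * _); rewrite mxE; apply/esym/op_eq => //.
by rewrite /= ltn_ord.
Qed.

(** * Positivity and mass of the density after the Euler step *)

Section EulerStep.
Context {R : realType} (D : data R) (Mn : nat -> int -> R -> R).
Hypothesis grav_gt0 : 0 < grav D.
Hypothesis lay_gt0 : forall a, in_layers D a -> 0 < lay D a.
Hypothesis lay_sum : \sum_(1 <= a < (nlay D).+1) lay D a = 1.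
Hypothesis dx_gt0 : forall i, 0 < dx D i.
Hypothesis dt_gt0 : 0 < dt D.
Hypothesis dep_ge0 : forall i, 0 <= dep D i.
Hypothesis hnew_gt0 : forall i, 0 < hnew D i.
Hypothesis cfl : CFL D.
Hypothesis euler : Euler_step D Mn.
Local Notation g := (grav D).
Implicit Types (a : nat) (i : int).

Lemma sigma_ge0 i : 0 <= sigma D i.
Proof. by rewrite divr_ge0// ltW. Qed.

(** Reconstruction at an interface only removes water: the interface bottom is
    not below the bottom of the cell. *)
Lemma hL_le i : hL D i <= dep D i.
Proof.
rewrite ge_max dep_ge0 andbT.
have : zb D i <= zbI D i by rewrite le_max lexx.
by lra.
Qed.

Lemma hR_le i : hR D (i - 1) <= dep D i.
Proof.
rewrite /hR subrK ge_max dep_ge0 andbT.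
have : zb D i <= zbI D (i - 1) by rewrite le_max subrK lexx orbT.
by lra.
Qed.

Lemma hL_ge0 i : 0 <= hL D i. Proof. by rewrite le_max lexx orbT. Qed.

Lemma hR_ge0 i : 0 <= hR D i. Proof. by rewrite le_max lexx orbT. Qed.

Lemma MbarR_own a i : MbarR D a (i - 1) = maxwellian D (hR D (i - 1)) (vel D a i).
Proof. by rewrite /MbarR subrK. Qed.

Lemma tame_Mbar a i : tame (Mbar D a i).
Proof. exact: tame_maxwellian. Qed.

Lemma tame_MbarL a i : tame (MbarL D a i).
Proof. exact: tame_maxwellian. Qed.

Lemma tame_MbarR a i : tame (MbarR D a i).
Proof. exact: tame_maxwellian. Qed.

Lemma tame_MI a i : tame (MI D a i).
Proof.
have tL := tame_MbarL a i; have tR := tame_MbarR a i.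
by rewrite /MI /MbarI; solve_tame.
Qed.

Lemma tame_dMbarL a i : tame (dMbarL D a i).
Proof.
have t := tame_Mbar a i; have tL := tame_MbarL a i.
by rewrite /dMbarL; solve_tame.
Qed.

Lemma tame_dMbarR a i : tame (dMbarR D a i).
Proof.
have t := tame_Mbar a i; have tR := tame_MbarR a (i - 1).
by rewrite /dMbarR; solve_tame.
Qed.

Lemma tame_flux a i : tame (fun xi => xi * (MI D a i xi - MI D a (i - 1) xi)).
Proof. by have t := tame_MI a i; have t' := tame_MI a (i - 1); solve_tame. Qed.

(** The corrections delta M are grouped apart because they carry no mass. *)
Lemma Mstar_split a i : Mstar D a i = fun xi =>
  lay D a * Mbar D a i xi - sigma D i *
    (xi * (MI D a i xi - MI D a (i - 1) xi)
     + lay D a * (dMbarL D a i xi - dMbarR D a i xi)).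
Proof. by apply/funext => xi; rewrite /Mstar /M /dML /dMR; ring. Qed.

Lemma tame_Mstar a i : tame (Mstar D a i).
Proof.
have t1 := tame_Mbar a i; have t2 := tame_flux a i.
have t3 := tame_dMbarL a i; have t4 := tame_dMbarR a i.
by rewrite Mstar_split; solve_tame.
Qed.

Lemma integ_dMbarL a i : integ (dMbarL D a i) = 0.
Proof.
have -> : dMbarL D a i = fun xi => (xi - vel D a i) * Mbar D a i xi
    - (xi - vel D a i) * MbarL D a i xi.
  by apply/funext => xi; rewrite /dMbarL mulrBr.
have t := tame_Mbar a i; have tL := tame_MbarL a i.
rewrite integB; [|by apply/tame_integrable; solve_tame..].
by rewrite !integ_centered_maxwellian ?hL_ge0// subrr.
Qed.

Lemma integ_dMbarR a i : integ (dMbarR D a i) = 0.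
Proof.
have -> : dMbarR D a i = fun xi => (xi - vel D a i) * Mbar D a i xi
    - (xi - vel D a i) * MbarR D a (i - 1) xi.
  by apply/funext => xi; rewrite /dMbarR mulrBr.
have t := tame_Mbar a i; have tR := tame_MbarR a (i - 1).
rewrite integB; [|by apply/tame_integrable; solve_tame..].
by rewrite MbarR_own !integ_centered_maxwellian ?hR_ge0// subrr.
Qed.

Lemma integ_Mstar a i :
  integ (Mstar D a i) = lay D a * dep D i - sigma D i * netflux D a i.
Proof.
have t1 := tame_Mbar a i; have t2 := tame_flux a i.
have t3 := tame_dMbarL a i; have t4 := tame_dMbarR a i.
rewrite Mstar_split integB; [|by apply/tame_integrable; solve_tame..].
congr (_ - _).
  rewrite (integZ _ _ (tame_integrable _ t1)).
  by rewrite integ_maxwellian.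
rewrite integZ; last by apply/tame_integrable; solve_tame.
congr (_ * _); rewrite integD; [|by apply/tame_integrable; solve_tame..].
rewrite [X in _ + X]integZ; last by apply/tame_integrable; solve_tame.
rewrite [X in _ * X]integB; [|by apply/tame_integrable; solve_tame..].
by rewrite integ_dMbarL integ_dMbarR subrr mulr0 addr0.
Qed.

Lemma hnewE i :
  hnew D i = dep D i - sigma D i * \sum_(1 <= p < (nlay D).+1) netflux D p i.
Proof.
rewrite /hnew (eq_bigr _ (fun a _ => integ_Mstar a i)) sumrB -mulr_suml lay_sum.
by rewrite mul1r mulr_sumr.
Qed.

(** The formula for G also gives 0 at the bottom, where the sum is empty, and at
    the surface, where the l_j sum to 1; so it holds at every interface. *)
Lemma G_sum a i : (a <= nlay D)%N -> G D a i =
  (\sum_(1 <= j < a.+1) (netflux D j i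
     - lay D j * \sum_(1 <= p < (nlay D).+1) netflux D p i)) / dx D i.
Proof.
move=> aN; rewrite /G; case: ifPn => // /orP[/eqP ->|/eqP ->].
  by rewrite big_geq// mul0r.
by rewrite sumrB -mulr_suml lay_sum mul1r subrr mul0r.
Qed.

Lemma G0 i : G D 0 i = 0. Proof. by rewrite /G eqxx. Qed.

Lemma GN i : G D (nlay D) i = 0. Proof. by rewrite /G eqxx orbT. Qed.

(** G is designed for this identity: the exchange redistributes the mass so that
    each layer keeps its fixed proportion l_a of the total depth. *)
Lemma mass_balance a i : in_layers D a ->
  lay D a * hnew D i =
  integ (Mstar D a i) + dt D * (G D a i - G D a.-1 i).
Proof.
move=> /andP[a1 aN]; rewrite !G_sum//; last exact: leq_trans (leq_pred _) aN.
case: a a1 aN => // a _ aN; rewrite big_nat_recr//= integ_Mstar hnewE /sigma.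
by field; rewrite gt_eqF.
Qed.

Definition exchange_rate i a : R := dt D * (G D a i / hnew D i).

Lemma exchange_rate_le0 i a : (exchange_rate i a <= 0) = (G D a i <= 0).
Proof.
by rewrite /exchange_rate pmulr_rle0// pmulr_lle0// invr_gt0.
Qed.

Lemma upwind_op_Mnbar a i xi : in_layers D a ->
  upwind_op (lay D) (exchange_rate i) (fun b => Mnbar D Mn b i xi) a =
  Mstar D a i xi.
Proof.
move=> a_in; have := euler a i xi a_in; have la := lay_gt0 a a_in.
rewrite /upwind_op /upwind !exchange_rate_le0 /exchange -/(Mnbarup D Mn a i xi)
  -/(Mnbarup D Mn a.-1 i xi) {1}/Mnbar => ->.
by rewrite /exchange_rate; field; rewrite !gt_eqF.
Qed.

(** A constant does not see the upwinding, and [mass_balance] remains. *)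
Lemma upwind_op_hnew a i : in_layers D a ->
  upwind_op (lay D) (exchange_rate i) (fun=> hnew D i) a = integ (Mstar D a i).
Proof.
move=> a_in; rewrite /upwind_op /upwind !if_same mass_balance// /exchange_rate.
by field; rewrite gt_eqF.
Qed.

(** The same inverse matrix solves the system of densities at every xi and the
    system of depths; comparing the two gives the mass of the densities. *)
Lemma Mnbar_combination i : exists w : nat -> nat -> R,
  (forall a, in_layers D a -> Mnbar D Mn a i =
    fun xi => \sum_(1 <= k < (nlay D).+1) w a k * Mstar D k i xi) /\
  (forall a, in_layers D a -> hnew D i =
    \sum_(1 <= k < (nlay D).+1) w a k * integ (Mstar D k i)).
Proof.
have c0 : exchange_rate i 0 = 0 by rewrite /exchange_rate G0 mul0r mulr0.
have cN : exchange_rate i (nlay D) = 0 by rewrite /exchange_rate GN mul0r mulr0.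
have [w wE] := upwind_op_inverse (nlay D) (lay D) (exchange_rate i) lay_gt0 c0 cN.
exists w; split=> a a_in.
  apply/funext => xi; rewrite (wE (fun b => Mnbar D Mn b i xi) a a_in).
  by apply: eq_big_nat => k k_in; rewrite upwind_op_Mnbar.
rewrite [LHS](wE (fun=> hnew D i) a a_in).
by apply: eq_big_nat => k k_in; rewrite upwind_op_hnew.
Qed.

Lemma tame_Mnbar a i : in_layers D a -> tame (Mnbar D Mn a i).
Proof.
move=> a_in; have [w [wM _]] := Mnbar_combination i; rewrite wM//.
by apply: tame_sum => k _; have := tame_Mstar k i => t; solve_tame.
Qed.

Lemma integ_Mnbar a i : in_layers D a -> integ (Mnbar D Mn a i) = hnew D i.
Proof.
move=> a_in; have [w [wM wh]] := Mnbar_combination i.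
rewrite wM// (wh a a_in).
rewrite integ_sum => [|k _]; last by have := tame_Mstar k i => t; solve_tame.
by apply: eq_bigr => k _; rewrite integZ//; exact/tame_integrable/tame_Mstar.
Qed.

(** For xi > 0 the outgoing part of the scheme is u M_L + (xi - u) M_R, up to an
    incoming part of the good sign, and symmetrically for xi < 0.  Since
    M_L, M_R <= M, and M vanishes for |xi - u| > s = sqrt (2 g h), it is at
    most (|u| + s) M, which the CFL condition absorbs into M. *)
Lemma Mstar_ge0 a i xi : in_layers D a -> 0 <= Mstar D a i xi.
Proof.
move=> a_in; have la := lay_gt0 a a_in.
pose s := Num.sqrt (2 * g * dep D i).
have s0 : 0 <= s by rewrite sqrtr_ge0.
have sg0 := sigma_ge0 i.
have cfl' : sigma D i * (`|vel D a i| + s) <= 1.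
  rewrite /sigma mulrAC ler_pdivrMr// mul1r.
  apply: le_trans (ltW (cfl a i a_in)); rewrite -/s.
  by apply: ler_wpM2l; [exact: ltW | lra].
have ML0 b j : 0 <= MbarL D b j xi by exact: maxwellian_ge0.
have MR0 b j : 0 <= MbarR D b j xi by exact: maxwellian_ge0.
have M0 : 0 <= Mbar D a i xi by exact: maxwellian_ge0.
have LM : MbarL D a i xi <= Mbar D a i xi by apply: le_maxwellian => //; exact: hL_le.
have RM : MbarR D a (i - 1) xi <= Mbar D a i xi.
  by rewrite MbarR_own; apply: le_maxwellian => //; exact: hR_le.
have dist x : 0 <= x <= Mbar D a i xi -> (xi - vel D a i) * x <= s * Mbar D a i xi
    /\ - ((xi - vel D a i) * x) <= s * Mbar D a i xi.
  move=> /andP[x0 xM]; have [far|] := ltP s `|xi - vel D a i|.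
    have M00 : Mbar D a i xi = 0 by exact: maxwellian_far.
    have -> : x = 0 by apply/le_anti; rewrite x0 -M00 xM.
    by rewrite M00 !mulr0 oppr0.
  rewrite ler_norml => /andP[? ?]; split; nra.
have vdist x : 0 <= x <= Mbar D a i xi -> vel D a i * x <= `|vel D a i| * Mbar D a i xi
    /\ - (vel D a i * x) <= `|vel D a i| * Mbar D a i xi.
  move=> /andP[x0 xM]; have u0 := normr_ge0 (vel D a i).
  have := ler_norm (vel D a i); have := ler_norm (- vel D a i); rewrite normrN.
  by move=> ? ?; split; nra.
have [dL1 dL2] := dist (MbarL D a i xi) (introT andP (conj (ML0 _ _) LM)).
have [dR1 dR2] := dist (MbarR D a (i - 1) xi) (introT andP (conj (MR0 _ _) RM)).
have [vL1 vL2] := vdist (MbarL D a i xi) (introT andP (conj (ML0 _ _) LM)).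
have [vR1 vR2] := vdist (MbarR D a (i - 1) xi) (introT andP (conj (MR0 _ _) RM)).
have bound z : z <= (`|vel D a i| + s) * Mbar D a i xi ->
    sigma D i * z <= Mbar D a i xi.
  move=> zle; apply: (le_trans (ler_wpM2l sg0 zle)).
  by rewrite mulrA -[leRHS]mul1r ler_wpM2r.
rewrite Mstar_split /MI /dMbarL /dMbarR /MbarI.
set m := Mbar D a i xi; set mL := MbarL D a i xi; set mR := MbarR D a (i - 1) xi.
set nR := MbarR D a i xi; set nL := MbarL D a (i - 1) xi.
set u := vel D a i; set sg := sigma D i.
have [xi0|xi0|xi0] := ltgtP xi 0; rewrite /= ?mul0r ?mul1r ?add0r ?addr0.
- have := bound ((u - xi) * mL - u * mR) _; rewrite -/m -/u -/sg.
  have -> : lay D a * m - sg * (xi * (lay D a * nR - lay D a * mR)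
      + lay D a * ((xi - u) * (m - mL) - (xi - u) * (m - mR))) =
      lay D a * (m - sg * ((u - xi) * mL - u * mR) + sg * (- xi * nR)) by ring.
  move=> H; apply: mulr_ge0; first exact: ltW.
  apply: addr_ge0; first (rewrite subr_ge0; apply: H).
    by rewrite mulrBl; move: vR2 dL2; rewrite -/u -/mL -/mR -/m; lra.
  apply: mulr_ge0; first exact: sg0.
  by apply: mulr_ge0; [rewrite oppr_ge0 ltW | exact: MR0].
- have := bound (u * mL + (xi - u) * mR) _; rewrite -/m -/u -/sg.
  have -> : lay D a * m - sg * (xi * (lay D a * mL - lay D a * nL)
      + lay D a * ((xi - u) * (m - mL) - (xi - u) * (m - mR))) =
      lay D a * (m - sg * (u * mL + (xi - u) * mR) + sg * (xi * nL)) by ring.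
  move=> H; apply: mulr_ge0; first exact: ltW.
  apply: addr_ge0; first (rewrite subr_ge0; apply: H).
    by rewrite mulrDl; move: vL1 dR1; rewrite -/u -/mL -/mR -/m; lra.
  apply: mulr_ge0; first exact: sg0.
  by apply: mulr_ge0; [exact: ltW | exact: ML0].
- have := bound (u * mL + (xi - u) * mR) _; rewrite -/m -/u -/sg.
  have -> : lay D a * m - sg * (xi * (lay D a * 0 - lay D a * 0)
      + lay D a * ((xi - u) * (m - mL) - (xi - u) * (m - mR))) =
      lay D a * (m - sg * (u * mL + (xi - u) * mR)) by rewrite xi0; ring.
  move=> H; apply: mulr_ge0; first exact: ltW.
  rewrite subr_ge0; apply: H.
  by rewrite mulrDl; move: vL1 dR1; rewrite -/u -/mL -/mR -/m; lra.
Qed.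

Lemma Mnbar_ge0 a i xi : in_layers D a -> 0 <= Mnbar D Mn a i xi.
Proof.
apply: (upwind_op_ge0 (nlay D) (lay D) (exchange_rate i)
  (fun b => Mnbar D Mn b i xi)) => //.
- by rewrite /exchange_rate G0 mul0r mulr0.
- by rewrite /exchange_rate GN mul0r mulr0.
- by move=> b b_in; rewrite upwind_op_Mnbar//; exact: Mstar_ge0.
Qed.

End EulerStep.

(** * The entropy balance and the viscous step *)

Section EntropyFluxes.
Context {R : realType} (D : data R) (Mn : nat -> int -> R -> R).
Hypothesis grav_gt0 : 0 < grav D.
Implicit Types (a : nat) (i : int).

Lemma tame_HtildeL a i : tame (HtildeL D a i).
Proof.
have t1 := tame_Mbar D grav_gt0 a i; have t2 := tame_MbarL D grav_gt0 a i.
have t3 := tame_MbarR D grav_gt0 a i.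
have t4 := tame_dMbarL D grav_gt0 a i.
have h1 := tame_H D _ (zb D i) t1; have h2 := tame_H D _ (zbI D i) t2.
have h3 := tame_H D _ (zbI D i) t3.
by rewrite /HtildeL; solve_tame.
Qed.

Lemma tame_HtildeR a i : tame (HtildeR D a i).
Proof.
have t1 := tame_Mbar D grav_gt0 a i; have t2 := tame_MbarL D grav_gt0 a (i - 1).
have t3 := tame_MbarR D grav_gt0 a (i - 1); have t4 := tame_dMbarR D grav_gt0 a i.
have h1 := tame_H D _ (zb D i) t1; have h2 := tame_H D _ (zbI D (i - 1)) t2.
have h3 := tame_H D _ (zbI D (i - 1)) t3.
by rewrite /HtildeR; solve_tame.
Qed.

Lemma tame_Hhat a i :
  (forall b, in_layers D b -> tame (Mnbar D Mn b i)) -> (a <= nlay D)%N ->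
  tame (Hhat D Mn a i).
Proof.
move=> tM; rewrite /Hhat /Mnbarup; case: a => [|a] aN.
  rewrite G0 mul0r (_ : (fun=> _) = fun=> 0).
    by split; [exact: measurable_cst | exists 0 => x; rewrite normr0].
  by apply/funext => xi; rewrite mul0r.
have t1 : tame (Mnbar D Mn a.+1 i) by apply: tM; rewrite /in_layers aN.
have [Gneg|Gpos] := boolP (G D a.+1 i <= 0).
  by have h := tame_H D _ (zb D i) t1; solve_tame.
have t2 : tame (Mnbar D Mn a.+2 i).
  apply: tM; rewrite /in_layers /= ltn_neqAle aN andbT.
  by apply: contra Gpos => /eqP ->; rewrite GN.
by have h := tame_H D _ (zb D i) t2; solve_tame.
Qed.

(** v (w - v) = (w + v)(w - v)/2 - (w - v)^2/2 for each neighbour w of v: a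
    difference of fluxes minus a square. *)
Lemma viscous_rhs_dissip (v : nat -> int -> R) a i :
  viscous_rhs D v a i * v a i = viscous_dissip D v a i.
Proof.
rewrite /viscous_rhs /viscous_dissip.
set A := (dx D (i + 1) + dx D i)^-1; set B := (dx D i + dx D (i - 1))^-1.
set C := (hlay D a.+1 i + hlay D a i)^-1; set E := (hlay D a i + hlay D a.-1 i)^-1.
set F := (dx D i)^-1.
by case: (a == nlay D); case: (a == 1%N); field.
Qed.

(** The midpoint rule is exact for the square:
    (un^2 - ut^2) / 2 = (un - ut) (un + ut) / 2. *)
Lemma energy_viscous a i h (ut un : R) (q v : R) :
  lay D a * h * un = lay D a * h * ut + dt D * q -> v = (ut + un) / 2 ->
  energy D a i h un = energy D a i h ut + dt D * (q * v).
Proof.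
move=> step ->; have -> : dt D * (q * ((ut + un) / 2)) = dt D * q * ((ut + un) / 2).
  by ring.
have -> : dt D * q = lay D a * h * un - lay D a * h * ut by rewrite step; ring.
by rewrite /energy; field.
Qed.

End EntropyFluxes.

Theorem proposition5p1 (R : realType) (D : data R)
    (Mn : nat -> int -> R -> R) (un : nat -> int -> R)
    (grav_gt0 : 0 < grav D) (visc_ge0 : 0 <= visc D) (fric_ge0 : 0 <= fric D)
    (nlay_ge1 : (1 <= nlay D)%N)
    (lay_gt0 : forall a, in_layers D a -> 0 < lay D a)
    (lay_sum : \sum_(1 <= a < (nlay D).+1) lay D a = 1)
    (dx_gt0 : forall i, 0 < dx D i) (dt_gt0 : 0 < dt D)
    (dep_ge0 : forall i, 0 <= dep D i)
    (dep_gt0 : (2 <= nlay D)%N -> forall i, 0 < dep D i)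
    (hnew_gt0 : forall i, 0 < hnew D i)
    (cfl : CFL D)
    (euler : Euler_step D Mn)
    (viscous : viscous_step D Mn un)
    (a : nat) (i : int) (a_in : in_layers D a)
    (d e : R -> R)
    (d_int : (@lebesgue_measure R).-integrable [set: R] (EFin \o d))
    (e_int : (@lebesgue_measure R).-integrable [set: R] (EFin \o e))
    (relation : kinetic_relation D Mn a i d e)
    (d_le : forall xi, d xi <= d_bound D Mn a i xi)
    (e_le : forall xi, e xi <= e_bound D Mn a i xi) :
  energy D a i (hnew D i) (un a i) <=
  energy D a i (dep D i) (vel D a i)
  + lay D a *
    (- sigma D i * (integ (HtildeL D a i) - integ (HtildeR D a i))
     - dt D * (integ (Hhat D Mn a i) - integ (Hhat D Mn a.-1 i))
     + integ d + integ e)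
  + dt D * viscous_dissip D (umid Mn un) a i.
Proof.
have la := lay_gt0 a a_in.
have tM b : in_layers D b -> tame (Mnbar D Mn b i).
  by move=> b_in; exact: tame_Mnbar.
have mass : integ (Mnbar D Mn a i) = hnew D i by exact: integ_Mnbar.
have MnE : Mn a i = fun xi => lay D a * Mnbar D Mn a i xi.
  by apply/funext => xi; rewrite /Mnbar mulrC divfK ?gt_eqF.
have htE : htilde Mn a i = lay D a * hnew D i.
  by rewrite /htilde MnE integZ ?mass//; exact/tame_integrable/tM.
have momentum : integ (fun xi => xi * Mnbar D Mn a i xi) = hnew D i * utilde Mn a i.
  have tMa := tM a a_in.
  rewrite /utilde htE MnE (_ : (fun xi => xi * (lay D a * _)) =
    fun xi => lay D a * (xi * Mnbar D Mn a i xi)); last first.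
    by apply/funext => xi; ring.
  by rewrite (integ_idZ _ _ tMa); field; rewrite !gt_eqF.
rewrite -viscous_rhs_dissip.
rewrite (energy_viscous D a i (hnew D i) (utilde Mn a i) (un a i)
  (viscous_rhs D (umid Mn un) a i) (umid Mn un a i)) //; last first.
  by have := viscous a i a_in; rewrite /hlaynew htE.
rewrite lerD2r.
have aN : (a <= nlay D)%N by case/andP: a_in.
have aN' : (a.-1 <= nlay D)%N := leq_trans (leq_pred a) aN.
have tHL := tame_HtildeL D grav_gt0 a i; have tHR := tame_HtildeR D grav_gt0 a i.
have tG := tame_Hhat D Mn a i tM aN; have tG' := tame_Hhat D Mn a.-1 i tM aN'.
have tH := tame_H D _ (zb D i) (tame_Mbar D grav_gt0 a i).
(* The integrated kinetic relation; the explicit part is tame, whereas d and e are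
   only known to be integrable. *)
have balance : integ (fun xi => H D (Mnbar D Mn a i xi) xi (zb D i)) =
    integ (fun xi => H D (Mbar D a i xi) xi (zb D i))
    + (- sigma D i * (integ (HtildeL D a i) - integ (HtildeR D a i))
       - dt D * (integ (Hhat D Mn a i) - integ (Hhat D Mn a.-1 i))
       + integ d + integ e).
  pose explicit xi := H D (Mbar D a i xi) xi (zb D i)
    + (- sigma D i * (HtildeL D a i xi - HtildeR D a i xi)
       + - dt D * (Hhat D Mn a i xi - Hhat D Mn a.-1 i xi)).
  have t_explicit : tame explicit by rewrite /explicit; solve_tame.
  rewrite (_ : (fun xi => H D (Mnbar D Mn a i xi) xi (zb D i)) =
    fun xi => explicit xi + (d xi + e xi)); last first.
    by apply/funext => xi; rewrite relation /explicit; ring.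
  rewrite integD; first last.
  - exact: (integrableD measurableT d_int e_int).
  - exact: tame_integrable.
  rewrite (integD d e)// /explicit.
  rewrite integD; [|by apply/tame_integrable; solve_tame..].
  rewrite [X in _ + X + _]integD; [|by apply/tame_integrable; solve_tame..].
  rewrite (integZB _ _ (- sigma D i) tHL tHR) (integZB _ _ (- dt D) tG tG').
  by ring.
have entropy_min : energy D a i (hnew D i) (utilde Mn a i) <=
    lay D a * integ (fun xi => H D (Mnbar D Mn a i xi) xi (zb D i)).
  rewrite (_ : energy _ _ _ _ _ = lay D a * (hnew D i / 2 * utilde Mn a i ^+ 2
      + grav D / 2 * hnew D i * hnew D i + grav D * zb D i * hnew D i)).
    apply: ler_wpM2l; first exact: ltW.
    apply: kinetic_entropy_min => //.
    - exact: tM.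
    - by move=> xi; exact: Mnbar_ge0.
    - exact: ltW.
  by rewrite /energy; field.
apply: (le_trans entropy_min); rewrite balance mulrDr lerD2r.
rewrite integ_H_maxwellian// le_eqVlt; apply/orP; left; apply/eqP.
by rewrite /energy; field.
Qed.
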